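(* Let $d\ge1$, $k\in\{1,\dots,d\}$ and $A\in H_{2d}^+(\mathbb{C})$ satisfy Assumptions I' and II'. Then for all $w\in\mathcal{S}$, $\langle u_{1/\overline{w}},\Phi'(w)u_w\rangle\neq0$. Define, for $w\in\mathcal{S}$, $\alpha_w\in\mathbb{C}^*$ and $P_w\in M_d(\mathbb{C})$ by $$\alpha_w=\frac{1}{\langle u_{1/\overline{w}},\Phi'(w)u_w\rangle},\qquad P_wx=\langle u_{1/\overline{w}},x\rangle u_w\quad(x\in\mathbb{C}^d).$$ Then for all $z\in\mathbb{C}^*\setminus\mathcal{S}$, $$\Phi(z)^{-1}=\sum_{w\in\mathcal{S}}\frac{\alpha_w}{z-w}P_w+\frac{1}{p_{2d-k}}\Psi_{2d-k-1}.$$ Moreover, $\big((u_w)_{w\in\mathcal{S}_{<1}},(u_i^{A_{RL}})_{i=1}^k\big)$ and $\big((u_w)_{w\in\mathcal{S}_{>1}},(u_i^{A_{LR}})_{i=1}^k\big)$ are bases of $\mathbb{C}^d$.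
   Context: $H_n^+(\mathbb{C})$ is the set of $n\times n$ complex Hermitian positive definite matrices; $\langle x,y\rangle=x^*y$ on $\mathbb{C}^d$. A matrix $A\in H_{2d}^+(\mathbb{C})$ is written in $d\times d$ blocks $A=\begin{pmatrix} A_{LL} & A_{LR} \\ A_{RL} & A_{RR} \end{pmatrix}$. Define $\Phi(z)=A_{LL}+A_{RR}+A_{LR}z+A_{RL}z^{-1}\in M_d(\mathbb{C})$ for $z\in\mathbb{C}^*$ (with complex derivative $\Phi'$), $\mathcal{S}=\{z\in\mathbb{C}^*:\det\Phi(z)=0\}$, $\mathcal{S}_{<1}=\{w\in\mathcal{S}:|w|<1\}$, $\mathcal{S}_{>1}=\{w\in\mathcal{S}:|w|>1\}$; one has $\mathcal{S}=\mathcal{S}_{<1}\sqcup\mathcal{S}_{>1}$ and $w\in\mathcal{S}$ iff $1/\overline{w}\in\mathcal{S}$. Let $\Psi(z)=z\Phi(z)=A_{LR}z^2+(A_{LL}+A_{RR})z+A_{RL}$ for $z\in\mathbb{C}$. Write $\det\Psi(z)=\sum_{l=0}^{2d}p_lz^l$ with $p_l\in\mathbb{C}$, and $\mathrm{adj}\,\Psi(z)=\sum_{l=0}^{2d-2}\Psi_lz^l$ with $\Psi_l\in M_d(\mathbb{C})$, where $\mathrm{adj}$ denotes the adjugate matrix. Assumption I': $\mathrm{rank}(A_{LR})=d-k$; bases $(u_i^{A_{LR}})_{i=1}^k$ of $\ker A_{LR}$ and $(u_i^{A_{RL}})_{i=1}^k$ of $\ker A_{RL}$ are fixed. Assumption II':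 every $w\in\mathcal{S}$ is a simple root of the polynomial $\det\Psi(z)$ with $\dim\ker\Phi(w)=1$, and $0$ is a root of $\det\Psi(z)$ of multiplicity exactly $k$. (Then $\det\Psi$ has degree exactly $2d-k$, so $p_{2d-k}\ne0$.) For each $w\in\mathcal{S}$ a vector $u_w\neq0$ spanning $\ker\Phi(w)$ is fixed. *)

(* Defs.v *)
From HB Require Import structures.
From mathcomp Require Import all_boot all_order all_algebra.
From mathcomp Require Import all_classical all_reals all_analysis.
From mathcomp Require Export complex.

Set Implicit Arguments.
Unset Strict Implicit.
Unset Printing Implicit Defensive.

Import Order.TTheory GRing.Theory Num.Theory.
Import numFieldNormedType.Exports.

Local Open Scope classical_set_scope.
Local Open Scope ring_scope.
Local Open Scope sesquilinear_scope.

Section Definitions.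
Context {R : realType} {d : nat}.
Local Notation C := R[i].
Implicit Types (A : 'M[C]_(d + d)) (u : C -> 'cV[C]_d).

(* Antilinear in the first argument. *)
Definition hdot n (x y : 'cV[C]_n) : C := (x ^t* *m y) 0 0.

(* In the order of R[i], 0 < z means that z is real and positive. *)
Definition hermitian_posdef n (M : 'M[C]_n) : Prop :=
  M \is hermsymmx /\ forall x : 'cV[C]_n, x != 0 -> 0 < hdot x (M *m x).

Definition kerv m n (M : 'M[C]_(m, n)) : {vspace 'cV[C]_n} :=
  lker (linfun (mulmx M : 'cV[C]_n -> 'cV[C]_m)).

Definition blockLL A : 'M[C]_d := ulsubmx A.
Definition blockLR A : 'M[C]_d := ursubmx A.
Definition blockRL A : 'M[C]_d := dlsubmx A.
Definition blockRR A : 'M[C]_d := drsubmx A.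

Definition Phi A (z : C) : 'M[C]_d :=
  blockLL A + blockRR A + z *: blockLR A + z^-1 *: blockRL A.

(* derive1 over the field R[i]: the limit of difference quotients with complex
   increments. *)
Definition dPhi A : C -> 'M[C]_d := derive1 (Phi A).

Definition Sing A : set C := [set z | z != 0 /\ \det (Phi A z) = 0].
Definition Sing_lt1 A : set C := [set w | Sing A w /\ `|w| < 1].
Definition Sing_gt1 A : set C := [set w | Sing A w /\ `|w| > 1].

Definition Psi A (z : C) : 'M[C]_d :=
  z ^+ 2 *: blockLR A + z *: (blockLL A + blockRR A) + blockRL A.

(* Psi with the indeterminate in place of z. *)
Definition PsiX A : 'M[{poly C}]_d :=
  'X^2 *: map_mx polyC (blockLR A)
  + 'X *: map_mx polyC (blockLL A + blockRR A) + map_mx polyC (blockRL A).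

Definition detPsi A : {poly C} := \det (PsiX A).
Definition p_coef A (l : nat) : C := (detPsi A)`_l.
Definition Psi_coef A (l : nat) : 'M[C]_d :=
  map_mx (fun q : {poly C} => q`_l) (\adj (PsiX A)).

Definition pairing A u (w : C) : C := hdot (u (1 / w^*)) (dPhi A w *m u w).
Definition alpha A u (w : C) : C := 1 / pairing A u w.
(* The matrix of x |-> hdot (u (1 / w^* )) x *: u w, see mulmx_Pw. *)
Definition Pw u (w : C) : 'M[C]_d := u w *m (u (1 / w^*)) ^t*.

End Definitions.

Lemma derive1_laurent (K : numFieldType) m n (M N P : 'M[K]_(m, n)) (w : K) :
  w != 0 ->
  derive1 (fun z : K => M + z *: N + z^-1 *: P) w = N - w ^- 2 *: P.
Proof.
move=> w0.
have c0 : (fun h : K => h + w) @ (0 : K)^' --> 0 + w.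
  by apply: cvgD; [exact: nbhs_dnbhs | exact: cvg_cst].
have c : (fun h : K => N - (w * (h + w))^-1 *: P) @ (0 : K)^' -->
         N - w ^- 2 *: P.
  apply: cvgB; first exact: cvg_cst.
  apply: cvgZr_tmp; apply: cvgV; first by rewrite expf_eq0.
  rewrite (_ : w ^+ 2 = w * (0 + w)); last by rewrite add0r expr2.
  apply: (@cvgM K K (0 : K)^'); [exact: cvg_cst | exact: c0].
apply/cvg_lim => //; apply: cvg_trans c; apply: near_eq_cvg; near=> h.
have h0 : h != 0 by near: h; exact: nbhs_dnbhs_neq.
have hw : h + w != 0.
  by near: h; apply: (cvgr_neq0 _ c0); rewrite add0r.
have E : (h + w)^-1 - w^-1 = - (h * (w * (h + w))^-1).
  apply: (mulIf hw); apply: (mulIf w0); rewrite mulrBl mulVf// mulrBl mul1r.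
  rewrite mulrAC mulVf// mul1r opprD addrCA subrr addr0 !mulNr.
  by rewrite -!mulrA [(h + w) * w]mulrC mulVf ?mulf_neq0// mulr1.
rewrite opprD addrACA opprD [M + _ + _]addrACA subrr add0r -!scalerBl E addrK.
by rewrite scalerDr scaleNr scalerN !scalerA mulVf// mulKf// scale1r.
Unshelve. all: by end_near.
Qed.

Section Checks.
Context {R : realType} {d : nat}.
Local Notation C := R[i].
Implicit Types (A : 'M[C]_(d + d)) (u : C -> 'cV[C]_d).

Lemma mem_kerv m n (M : 'M[C]_(m, n)) (x : 'cV[C]_n) :
  (x \in kerv M) = (M *m x == 0).
Proof. by rewrite memv_ker lfunE. Qed.

Lemma mulmx_Pw u (w : C) (x : 'cV[C]_d) :
  Pw u w *m x = hdot (u (1 / w^*)) x *: u w.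
Proof.
by rewrite /Pw /hdot -mulmxA [X in _ *m X]mx11_scalar mul_mx_scalar.
Qed.

Lemma dPhiE A (w : C) : w != 0 ->
  dPhi A w = blockLR A - w ^- 2 *: blockRL A.
Proof. exact: derive1_laurent. Qed.

Lemma PsiE A (z : C) : z != 0 -> Psi A z = z *: Phi A z.
Proof.
move=> z0; rewrite /Psi /Phi !scalerDr !scalerA divff// scale1r -expr2.
by rewrite [z ^+ 2 *: _ + _]addrC.
Qed.

Lemma map_PsiX A (z : C) : map_mx (horner_eval z) (PsiX A) = Psi A z.
Proof.
apply/matrixP => i j; rewrite !mxE /horner_eval !hornerE.
by rewrite ?hornerXn.
Qed.

Lemma size_PsiX A i j : (size (PsiX A i j) <= 3)%N.
Proof.
rewrite !mxE; apply/leq_sizeP => l l3.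
rewrite !coefD coefXnM coefXM !coefC.
by case: l l3 => [|[|[|l]]] //= _; rewrite addr0 addr0.
Qed.

Lemma size_prod_le3 n (F : 'I_n -> {poly C}) :
  (forall i, (size (F i) <= 3)%N) -> (size (\prod_i F i)%R <= (2 * n).+1)%N.
Proof.
elim: n F => [|n IH] F HF; first by rewrite big_ord0 size_poly1.
rewrite big_ord_recl (leq_trans (size_polyMleq _ _))//.
have := IH _ (fun i => HF (lift ord0 i)); have := HF ord0.
by set a := size _; set b := size _ => ? ?; rewrite -subn1 leq_subLR
  (leq_trans (leq_add (_ : a <= 3)%N (_ : b <= (2 * n).+1)%N))// mulnS.
Qed.

Lemma size_det_le3 n (M : 'M[{poly C}]_n) :
  (forall i j, (size (M i j) <= 3)%N) -> (size (\det M) <= (2 * n).+1)%N.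
Proof.
move=> HM; apply: (leq_trans (size_sum _ _ _)); apply/bigmax_leqP => s _.
rewrite -signr_odd; case: (odd _); rewrite ?expr0 ?expr1 ?mul1r ?mulN1r ?size_polyN;
by apply: size_prod_le3 => i.
Qed.

Lemma det_Psi A (z : C) :
  \det (Psi A z) = \sum_(l < (2 * d).+1) p_coef A l * z ^+ l.
Proof.
rewrite -map_PsiX det_map_mx /horner_eval -/(detPsi A).
apply: horner_coef_wide; apply: size_det_le3; exact: size_PsiX.
Qed.

Lemma adj_Psi A (z : C) : (0 < d)%N ->
  \adj (Psi A z) = \sum_(l < (2 * d - 2).+1) z ^+ l *: Psi_coef A l.
Proof.
move=> d0; rewrite -map_PsiX -map_mx_adj; apply/matrixP => i j.
rewrite summxE [LHS]mxE /=.
rewrite -[LHS]/((\adj (PsiX A) i j).[z]) (@horner_coef_wide _ (2 * d - 2).+1).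
  by apply: eq_bigr => l _; rewrite [RHS]mxE [Psi_coef _ _ _ _]mxE mulrC.
rewrite [\adj _ i j]mxE /cofactor -signr_odd.
have -> : (2 * d - 2 = 2 * d.-1)%N by rewrite -subn1 mulnBr.
by case: (odd _); rewrite ?expr0 ?expr1 ?mul1r ?mulN1r ?size_polyN;
  apply: size_det_le3 => a b; rewrite 2!mxE; exact: size_PsiX.
Qed.

(* Sums \sum_(w \in Sing A) and enumerations fset_set (Sing_lt1 A) have default
   values when the set is infinite; this excludes that case. *)
Lemma finite_Sing A : (0 < mup 0 (detPsi A))%N -> finite_set (Sing A).
Proof.
move=> mu0; have p0 : detPsi A != 0.
  apply: contraTN mu0 => /eqP ->; rewrite -leqNgt /mup.
  case: arg_maxnP => [|i _ _]; first by rewrite expr0 dvd1p.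
  by rewrite -ltnS (leq_trans (ltn_ord i))// size_poly0.
have [s sE] : {s : seq C | forall x, x != 0 -> root (detPsi A) x -> x \in s}.
  have [s sE] := closed_field_poly_normal (detPsi A).
  by exists s => x _; rewrite sE rootZ ?lead_coef_eq0// root_prod_XsubC.
apply: (sub_finite_set _ (finite_seq s)) => w [w0 detw] /=; apply: sE => //.
have := det_map_mx (horner_eval w) (PsiX A).
rewrite map_PsiX PsiE// detZ detw mulr0 => /esym/eqP.
by rewrite /horner_eval rootE.
Qed.

End Checks.

(* Main.v *)
(* Write B = A_LR and H = A_LL + A_RR.  Since Phi(z)^* = Phi(1/conj z), the
   coefficients of det Psi and adj Psi are palindromic up to conjugation.  As
   B^* has corank k, row operations show that z^(k-1) divides adj Psi(z), so
   that Phi^-1 = z adj Psi / det Psi = Q / q with deg Q <= deg q = 2(d - k) and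
   q having simple roots, exactly the points of S.  The resolvent formula is
   then a partial fraction expansion; its residues come from differentiating
   Psi adj Psi = det Psi at w.

   For the bases, a relation sum_w c_w u_w + x = 0 with |w| < 1 and B^* x = 0
   makes x_0 = 0, x_n = sum_w c_w w^n u_w a decaying solution of
   B x_(n+1) + H x_n + B^* x_(n-1) = 0.  Its total energy
   sum_n <(x_n, x_(n+1)), A (x_n, x_(n+1))> telescopes to 0, so positivity of A
   forces x = 0, hence c = 0.  The symmetry w -> 1/conj w and the absence of
   singularities on the unit circle give the right number of vectors.  Outside
   the disk, exchange L and R and replace w by 1/w. *)
Require Import Defs.
From HB Require Import structures.
From mathcomp Require Import all_boot all_order all_algebra finmap.
From mathcomp Require Import all_classical all_reals all_analysis.
From mathcomp Require Import ring zify.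

Set Implicit Arguments.
Unset Strict Implicit.
Unset Printing Implicit Defensive.

Import Order.TTheory GRing.Theory Num.Theory.

Local Open Scope classical_set_scope.
Local Open Scope ring_scope.

(** * Partial fractions, simple roots and the adjugate of a linear pencil *)

(** After multiplication by [q] this is Lagrange interpolation: [h] has degree below [size s] and
    vanishes on [s]. The extra constant is the value of g / q at infinity, present because [g] may
    have the same degree as [q]. *)
Lemma partial_fractions (F : fieldType) (g q : {poly F}) (s : seq F) (z : F) :
  uniq s -> all (root q) s -> size q = (size s).+1 ->
  (size g <= (size s).+1)%N -> (forall w, w \in s -> q^`().[w] != 0) ->
  q.[z] != 0 ->
  g.[z] / q.[z] =
    \sum_(w <- s) g.[w] / q^`().[w] / (z - w) + g`_(size s) / lead_coef q.
Proof.
move=> us /allP rs szq szg q'0 qz0.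
have q0 : q != 0 by rewrite -size_poly_eq0 szq.
have lq0 : lead_coef q != 0 by rewrite lead_coef_eq0.
have divK w : w \in s -> q = (q %/ ('X - w%:P)) * ('X - w%:P).
  by move=> ws; rewrite divpK// dvdp_XsubCl rs.
have Lw w : w \in s -> (q %/ ('X - w%:P)).[w] = q^`().[w].
  by move=> ws; rewrite {2}(divK w ws) derivM derivXsubC !hornerE subrr mulr0 add0r.
have Lv w v x : w \in s -> v \in s -> v != w -> (q %/ ('X - w%:P)).[v] * x = 0.
  move=> ws vs vw; have /eqP := rs v vs; rewrite {1}(divK w ws) hornerM !hornerE.
  by move/eqP; rewrite mulf_eq0 subr_eq0 (negPf vw) orbF => /eqP ->; rewrite mul0r.
pose h := g - (g`_(size s) / lead_coef q) *: q
  - \sum_(w <- s) (g.[w] / q^`().[w]) *: (q %/ ('X - w%:P)).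
have h0 : h = 0.
  apply: (roots_geq_poly_eq0 (rs := s)) => //.
    apply/allP => v vs; rewrite rootE /h !hornerE horner_sum.
    rewrite (eqP (rs v vs)) mulr0 subr0 (bigD1_seq v)//= hornerZ Lw// divfK ?q'0//.
    rewrite big_seq_cond big1 ?addr0 ?subrr// => w /andP[ws wv].
    by rewrite hornerZ mulrC Lv// eq_sym.
  apply/leq_sizeP => j; rewrite leq_eqVlt => /orP[/eqP <-|sj].
    have lqE : lead_coef q = q`_(size s) by rewrite lead_coefE szq.
    rewrite /h !coefB coefZ coef_sum -lqE divfK// subrr sub0r big_seq big1 ?oppr0// => w ws.
    rewrite coefZ nth_default ?mulr0//.
    by rewrite size_divp ?polyXsubC_eq0// size_XsubC szq subn1.
  rewrite /h !coefB coefZ coef_sum (nth_default _ (leq_trans szg sj)).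
  rewrite [q`_j]nth_default ?szq// mulr0 subrr sub0r big_seq big1 ?oppr0// => w ws.
  rewrite coefZ nth_default ?mulr0//.
  by rewrite size_divp ?polyXsubC_eq0// size_XsubC szq subn1 ltnW.
apply: (mulIf qz0); rewrite divfK// mulrDl.
move/(congr1 (horner_eval z)): h0; rewrite /horner_eval /h !hornerE horner_sum.
move/eqP; rewrite subr_eq0 subr_eq addrC => /eqP ->.
rewrite addrC; congr (_ + _); rewrite mulr_suml big_seq [RHS]big_seq.
apply: eq_bigr => w ws; rewrite hornerZ -[RHS]mulrA; congr (_ * _).
have zw : z - w != 0.
  by rewrite subr_eq0; apply: contraNneq qz0 => ->; exact: rs.
by rewrite [in RHS](divK w ws) hornerM hornerXsubC mulrCA mulVf// mulr1.
Qed.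

Lemma deriv_simple_root (F : fieldType) (q : {poly F}) (w : F) :
  mup w q = 1%N -> q != 0 -> root q w /\ q^`().[w] != 0.
Proof.
move=> m1 q0; have := XsubC_dvd w q0; rewrite m1 /= dvdp_XsubCl => rw; split=> //.
have /factor_theorem[r qE] := rw.
have := mup_leq w 1 q0; rewrite m1 leqnn => /esym.
rewrite qE derivM derivXsubC !hornerE subrr mulr0 add0r; apply: contra => r0.
by rewrite expr2 dvdp_mul2r ?polyXsubC_eq0// dvdp_XsubCl.
Qed.

(* Row operations make the last k rows of E M0 vanish, so E M = D N with
   D = diag(1, .., 1, 'X, .., 'X). *)
Lemma adj_linear_pencil (F : fieldType) d k (M0 : 'M[F]_d)
    (M1 : 'M[{poly F}]_d) :
  (0 < k <= d)%N -> \rank M0 = (d - k)%N ->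
  \det (map_mx polyC M0 + 'X *: M1) != 0 ->
  exists Q : 'M[{poly F}]_d,
    \adj (map_mx polyC M0 + 'X *: M1) = 'X^(k.-1) *: Q.
Proof.
move=> /andP[k0 kd] rM; set M := _ + _ => M_neq0.
pose E := invmx (col_ebase M0).
have Eu : E \in unitmx by rewrite unitmx_inv col_ebase_unit.
have E0 : \det E != 0 by rewrite -unitfE -unitmxE.
have EM0 (i j : 'I_d) : (d - k <= i)%N -> (E *m M0) i j = 0.
  move=> di; rewrite -(mulmx_ebase M0) -!mulmxA mulKmx ?col_ebase_unit// rM.
  rewrite mxE big1// => l _; rewrite !mxE.
  by rewrite [(i < _)%N]ltnNge di andbF mul0r.
pose D := diag_mx (\row_(i < d) (if (i < d - k)%N then 1 else 'X : {poly F})).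
pose D' := diag_mx (\row_(i < d) (if (i < d - k)%N then 'X else 1 : {poly F})).
pose N := \matrix_(i < d, j < d) (if (i < d - k)%N then (map_mx polyC E *m M) i j
            else (map_mx polyC E *m M1) i j).
have EM : map_mx polyC E *m M = D *m N.
  apply/matrixP => i j; rewrite mul_diag_mx !mxE.
  case: ltnP => di; rewrite ?mul1r ?mxE//.
  transitivity ((map_mx polyC (E *m M0) + 'X *: (map_mx polyC E *m M1)) i j).
    by rewrite map_mxM /= scalemxAr -mulmxDr mxE.
  by rewrite mxE [X in X + _]mxE EM0// polyC0 add0r !mxE.
have DD : D *m D' = 'X%:M.
  rewrite /D /D' mulmx_diag -diag_const_mx; congr diag_mx.
  by apply/rowP => i; rewrite !mxE; case: ifP; rewrite ?mul1r ?mulr1.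
have detD : \det D = 'X^k.
  rewrite det_diag (eq_bigr (fun i : 'I_d => (if (i < d - k)%N then 1 else 'X))); last first.
    by move=> i _; rewrite mxE.
  rewrite -(big_mkord xpredT (fun i => if (i < d - k)%N then 1 else 'X)).
  rewrite (big_cat_nat (n := d - k))//= ?leq_subr//.
  rewrite big_nat big1 ?mul1r => [|i /andP[_ ->]//].
  rewrite big_nat (eq_bigr (fun=> 'X)) => [|i /andP[+ _]]; last by rewrite ltnNge => ->.
  by rewrite -big_nat prodr_const_nat subKn.
have detEM : (\det E)%:P * \det M = 'X^k * \det N.
  by rewrite -detD -det_mulmx -EM det_mulmx det_map_mx.
have N0 : \det N != 0.
  apply: contraTneq M_neq0 => N0; move: detEM; rewrite N0 mulr0 => /eqP.
  by rewrite mulf_eq0 polyC_eq0 (negPf E0) /= => ->.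
(* [E M = D N] and [D D' = 'X] give M^-1 = adj N D' E / (det N 'X), while det M = 'X^k det N / det
   E; their product carries the factor 'X^(k-1). *)
pose Q := \adj N *m D' *m map_mx polyC E.
have MQ : M *m Q = (\det N * 'X)%:M.
  have Em : map_mx polyC E \in unitmx.
    by rewrite unitmxE det_map_mx rmorph_unit// -unitmxE.
  apply: (can_inj (mulKmx Em)).
  rewrite mulmxA EM /Q !mulmxA -[D *m N *m _]mulmxA mul_mx_adj.
  by rewrite !mul_mx_scalar -!scalemxAl DD mul_scalar_mx scalerA.
exists ((\det E)^-1%:P *: Q).
have NX0 : \det N * 'X != 0 by rewrite mulf_neq0// polyX_eq0.
have cancelNX (B B' : 'M[{poly F}]_d) :
    (\det N * 'X) *: B = (\det N * 'X) *: B' -> B = B'.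
  move=> /matrixP BB; apply/matrixP => i j; have := BB i j.
  by rewrite !mxE => /(mulfI NX0).
apply: cancelNX; rewrite -mul_mx_scalar -MQ mulmxA mul_adj_mx mul_scalar_mx !scalerA.
congr (_ *: _); apply: (mulfI (_ : (\det E)%:P != 0)); first by rewrite polyC_eq0.
rewrite detEM -[in LHS](prednK k0) exprSr.
have : (\det E)%:P * (\det E)^-1%:P = 1 :> {poly F} by rewrite -polyCM mulfV.
by set e := (\det E)%:P; set e' := _^-1%:P => ee; rewrite -[LHS]mul1r -ee; ring.
Qed.

(** * Conjugate reversal of coefficients *)

Lemma poly_eq_nonzero (F : numFieldType) (p q : {poly F}) :
  (forall z, z != 0 -> p.[z] = q.[z]) -> p = q.
Proof.
move=> pq; apply/eqP; rewrite -subr_eq0; apply/eqP.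
(* Characteristic zero makes 1, 2, 3, ... distinct and nonzero, as many points as the size
   requires. *)
pose rs := [seq (i.+1)%:R : F | i <- iota 0 (size (p - q))].
apply: (roots_geq_poly_eq0 (rs := rs)); last by rewrite size_map size_iota.
- apply/allP => _ /mapP[i _ ->].
  by rewrite rootE !hornerE pq ?subrr// pnatr_eq0.
- rewrite map_inj_uniq ?iota_uniq// => i j /eqP.
  by rewrite eqr_nat eqSS => /eqP.
Qed.

(** Conjugating both argument and value conjugates the coefficients of [g]; replacing z by 1/z and
    multiplying by z^n reverses their order. *)
Lemma coef_conj_reversal (C : numClosedFieldType) n (f g : {poly C}) :
  (size f <= n.+1)%N -> (size g <= n.+1)%N ->
  (forall z, z != 0 -> f.[z] = z ^+ n * (g.[(z^-1)^*])^*) ->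
  forall l, (l <= n)%N -> f`_l = (g`_(n - l))^*.
Proof.
move=> sf sg fg l ln.
suff -> : f = \poly_(i < n.+1) (g`_(n - i))^* by rewrite coef_poly ltnS ln.
apply: poly_eq_nonzero => z z0; rewrite fg// horner_poly (horner_coef_wide _ sg).
rewrite rmorph_sum /= mulr_sumr (reindex_inj rev_ord_inj) /=.
apply: eq_bigr => i _; rewrite rmorphM rmorphXn /= conjCK subSS mulrCA.
congr (_ * _); rewrite exprVn -expfB_cond; last by rewrite (negPf z0) add0n leq_subr.
by rewrite subKn// -ltnS.
Qed.

(** * Decaying solutions of the three-term recurrence *)

(** Vandermonde argument by elimination: the shift minus [a] kills the mode [a] and multiplies every
    other mode by w - a. The exponents start at 1, where the sequence used in [decaying_modes_eq0]
    agrees with the sum of modes. *)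
Lemma exp_moments_eq0 (F : fieldType) (V : lmodType F) (s : seq F) (v : F -> V) :
  uniq s -> (forall w, w \in s -> w != 0) ->
  (forall n, \sum_(w <- s) w ^+ n.+1 *: v w = 0) ->
  forall w, w \in s -> v w = 0.
Proof.
elim: s v => [//|a s IH] v /= /andP[nas us] s0 hv.
have vs w : w \in s -> v w = 0.
  move=> ws; suff /eqP : (w - a) *: v w = 0.
    rewrite scaler_eq0 subr_eq0 => /predU1P[wa|/eqP//].
    by rewrite -wa ws in nas.
  apply: (IH (fun w => (w - a) *: v w)) => // [{ws}w ws|n].
    by apply: s0; rewrite inE ws orbT.
  transitivity (\sum_(w <- a :: s) w ^+ n.+2 *: v w
                - a *: \sum_(w <- a :: s) w ^+ n.+1 *: v w); last first.
    by rewrite !hv scaler0 subr0.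
  rewrite scaler_sumr -sumrB big_cons scalerA -exprS subrr add0r.
  apply: eq_bigr => z _; rewrite !scalerA -scalerBl; congr (_ *: _).
  by rewrite [z ^+ n.+2]exprSr mulrBr [a * _]mulrC.
move=> w; rewrite inE => /predU1P[->|/vs//].
have := hv 0%N; rewrite big_cons big_seq big1 ?addr0 => [|z /vs->]; last first.
  by rewrite scaler0.
by move/eqP; rewrite scaler_eq0 expf_eq0 /= (negPf (s0 a _)) ?mem_head// => /eqP.
Qed.

Lemma norm_le_contraction (C : numFieldType) (s : seq C) :
  (forall w, w \in s -> `|w| < 1) ->
  exists r : C, [/\ 0 <= r, r < 1 & forall w, w \in s -> `|w| <= r].
Proof.
elim: s => [|a s IH] hs; first by exists 0; split.
have [w ws|r [r0 r1 hr]] := IH; first by apply: hs; rewrite inE ws orbT.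
have [ar|ra] := real_leP (normr_real a) (ger0_real r0).
  by exists r; split=> // w; rewrite inE => /predU1P[->|/hr].
exists `|a|; split=> // [|w]; first by apply: hs; rewrite mem_head.
by rewrite inE => /predU1P[->//|/hr /le_trans]; apply; exact: ltW.
Qed.

Section DecayingModes.
Import numFieldNormedType.Exports.
Local Open Scope sesquilinear_scope.
Context (R : realType) (d : nat).
Local Notation C := R[i].
Implicit Types (x y z : 'cV[C]_d) (M B : 'M[C]_d).

Lemma hdotDr x y z : hdot x (y + z) = hdot x y + hdot x z.
Proof. by rewrite /hdot mulmxDr mxE. Qed.

Lemma hdot0l y : hdot 0 y = 0.
Proof. by rewrite /hdot trmx0 map_mx0 mul0mx mxE. Qed.

Lemma hdot0r x : hdot x 0 = 0.
Proof. by rewrite /hdot mulmx0 mxE. Qed.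

(** Let n tend to infinity. The order of R[i] makes [a], [l] and [r] real, so the limit is taken on
    real parts. *)
Lemma geometric_bound_le0 (a l r : C) : 0 <= r -> r < 1 ->
  (forall n, a <= l * r ^+ n) -> ~ 0 < a.
Proof.
move=> r0 r1 al a0.
have l0 : 0 <= l by apply: le_trans (ltW a0) _; have := al 0%N; rewrite mulr1.
have cplx (c : C) : 0 <= c -> c = (complex.Re c)%:C%C.
  by case: c => x y; rewrite lecE /= => /andP[/eqP -> _].
have {}al n : complex.Re a <= complex.Re l * complex.Re r ^+ n.
  have := al n; rewrite (cplx _ l0) (cplx _ r0) (cplx _ (ltW a0)) /=.
  by rewrite -rmorphXn -rmorphM lecR.
have {}r0 : 0 <= complex.Re r by move: r0; rewrite lecE => /andP[].
have {}r1 : complex.Re r < 1 by move: r1; rewrite ltcE => /andP[].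
have {}a0 : 0 < complex.Re a by move: a0; rewrite ltcE => /andP[].
have cv : (fun n => complex.Re l * complex.Re r ^+ n) @ \oo --> (0 : R).
  by apply: cvg_geometric; rewrite ger0_norm.
suff : complex.Re a <= 0 by rewrite leNgt a0.
rewrite -(cvg_lim (@Rhausdorff R) cv); apply: limr_ge; first exact: cvgP cv.
by apply: nearW.
Qed.

(* The energy of the pair (x (n + 1), x (n + 2)) is b (n + 1) - b n, where
   b n = <x (n + 1), B^* x n + M2 x (n + 1)> tends to 0. *)
Lemma decaying_recurrence_eq0 M1 M2 B (x : nat -> 'cV[C]_d) (K r : C) :
  (forall y z, (y != 0) || (z != 0) ->
    0 < hdot y (M1 *m y) + hdot y (B *m z) + hdot z (B ^t* *m y)
        + hdot z (M2 *m z)) ->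
  x 0%N = 0 ->
  (forall n, B *m x n.+2 + (M1 + M2) *m x n.+1 + B ^t* *m x n = 0) ->
  0 <= r -> r < 1 -> (forall n i, `|x n i 0| <= K * r ^+ n) ->
  forall n, x n = 0.
Proof.
move=> pos x0 rec r0 r1 xK.
have nneg y z : 0 <= hdot y (M1 *m y) + hdot y (B *m z) + hdot z (B ^t* *m y)
        + hdot z (M2 *m z).
  have [/eqP y0|y0] := boolP (y == 0); last by rewrite ltW// pos ?y0.
  have [/eqP z0|z0] := boolP (z == 0); last by rewrite ltW// pos ?z0 ?orbT.
  by rewrite y0 z0 !hdot0l !addr0.
pose b n := hdot (x n.+1) (B ^t* *m x n + M2 *m x n.+1).
have b_S n : b n.+1 - b n = hdot (x n.+1) (M1 *m x n.+1)
    + hdot (x n.+1) (B *m x n.+2) + hdot (x n.+2) (B ^t* *m x n.+1)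
    + hdot (x n.+2) (M2 *m x n.+2).
  (* Pairing the recurrence with x (n + 1) gives, up to sign, the defect of the telescoping
     identity. *)
  have := congr1 (hdot (x n.+1)) (rec n).
  rewrite mulmxDl !hdotDr hdot0r /b !hdotDr => e0.
  apply/eqP; rewrite -subr_eq0 -oppr0 -{}e0; apply/eqP.
  move: (hdot _ _) (hdot _ _) (hdot _ _) (hdot _ _) (hdot _ _) (hdot _ _).
  by move=> ? ? ? ? ? ?; ring.
(* Because x 0 = 0, b 0 is itself the energy of the first pair. *)
have b_0 : b 0%N = hdot (x 0%N) (M1 *m x 0%N)
    + hdot (x 0%N) (B *m x 1%N) + hdot (x 1%N) (B ^t* *m x 0%N)
    + hdot (x 1%N) (M2 *m x 1%N).
  by rewrite /b hdotDr x0 !hdot0l !add0r.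
have b_ge0 : 0 <= b 0%N by rewrite b_0.
have b_mono : {homo b : m n / (m <= n)%N >-> m <= n}.
  by apply: homo_leq => [//|? ? ?|n]; [exact: le_trans|rewrite -subr_ge0 b_S].
(* Nonnegativity of [K] is read off a coordinate; for d = 0 the bound [xK] is empty. *)
have K0 (i : 'I_d) : 0 <= K by have := xK 0%N i; rewrite mulr1; apply: le_trans.
have rn1 n : r ^+ n <= 1 by rewrite exprn_ile1// ltW.
pose L := \sum_i K * (\sum_j (`|B ^t* i j| + `|M2 i j|) * K).
have b_bound n : `|b n| <= L * r ^+ n.
  rewrite /b /hdot mxE mulr_suml (le_trans (ler_norm_sum _ _ _))// ler_sum// => i _.
  rewrite !mxE normrM norm_conjC -mulrA ler_pM//.
    by rewrite (le_trans (xK _ _))// ler_piMr ?(K0 i)// rn1.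
  rewrite -big_split /= mulr_suml (le_trans (ler_norm_sum _ _ _))// ler_sum// => j _.
  rewrite (le_trans (ler_normD _ _))// !normrM !mulrDl lerD// -mulrA ler_wpM2l//.
  by rewrite (le_trans (xK _ _))// ler_wpM2l ?(K0 j)// exprS ler_piMl ?exprn_ge0// ltW.
have b0 n : b n = 0.
  have bn_ge0 : 0 <= b n := le_trans b_ge0 (b_mono _ _ (leq0n n)).
  apply/eqP/negP => /negP bn0; have : 0 < b n by rewrite lt_neqAle eq_sym bn0.
  apply: (@geometric_bound_le0 _ L r) => // m.
  (* Monotonicity bounds the fixed number b n by b (max n m) <= L r^m, for every m. *)
  rewrite (le_trans (b_mono _ _ (leq_maxl n m)))//.
  rewrite -[b _]ger0_norm ?(le_trans b_ge0) ?b_mono// (le_trans (b_bound _))//.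
  rewrite ler_wpM2l ?sumr_ge0// => [i _|].
    by rewrite mulr_ge0 ?(K0 i)// sumr_ge0// => j _; rewrite mulr_ge0 ?addr_ge0 ?(K0 i).
  rewrite -(subnK (leq_maxr n m)) exprD ler_piMl ?exprn_ge0//.
(* The pair (x n, x (n + 1)) has energy b 0 or a difference of consecutive values of b, hence zero,
   against positivity. *)
case=> [//|n]; apply/eqP/negP => /negP xn.
have := pos (x n) (x n.+1); rewrite xn orbT => /(_ isT).
by case: n {xn} => [|n]; [rewrite -b_0 b0|rewrite -(b_S n) !b0 subrr]; rewrite ltxx.
Qed.

(** Weighted by w^n, the modes add up to a geometrically bounded solution of the recurrence, which
    [decaying_recurrence_eq0] annihilates; [exp_moments_eq0] then separates the modes. *)
Lemma decaying_modes_eq0 M1 M2 B (s : seq C) (v : C -> 'cV[C]_d) x :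
  (forall y z, (y != 0) || (z != 0) ->
    0 < hdot y (M1 *m y) + hdot y (B *m z) + hdot z (B ^t* *m y)
        + hdot z (M2 *m z)) ->
  uniq s -> (forall w, w \in s -> w != 0 /\ `|w| < 1) ->
  (forall w, w \in s -> (M1 + M2 + w *: B + w^-1 *: B ^t* ) *m v w = 0) ->
  B ^t* *m x = 0 -> \sum_(w <- s) v w + x = 0 ->
  forall w, w \in s -> v w = 0.
Proof.
move=> pos us s01 hv Bx vx.
have [|r [r0 r1 sr]] := @norm_le_contraction _ s; first by move=> w /s01[].
pose y n := \sum_(w <- s) w ^+ n *: v w.
have y0 : B ^t* *m y 0%N = 0.
  have : y 0%N + x = 0.
    by rewrite -vx; congr (_ + _); apply: eq_bigr => w _; rewrite scale1r.
  by move/(congr1 (mulmx (B ^t* ))); rewrite mulmxDr Bx addr0 mulmx0.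
have yrec n : B *m y n.+2 + (M1 + M2) *m y n.+1 + B ^t* *m y n = 0.
  rewrite !mulmx_sumr -!big_split big_seq big1//= => w ws.
  have [w0 _] := s01 w ws; rewrite -!scalemxAr.
  transitivity (w ^+ n.+1 *: ((M1 + M2 + w *: B + w^-1 *: B ^t* ) *m v w)).
    rewrite [in RHS]mulmxDl [in RHS]mulmxDl !scalerDr -!scalemxAl !scalerA -exprSr.
    have -> : w ^+ n.+1 * w^-1 = w ^+ n by rewrite exprSr mulfK.
    by rewrite [X in X + _ = _]addrC.
  by rewrite hv// scaler0.
apply: (exp_moments_eq0 us) => [w /s01[]//|n].
(* Index 0 is overwritten by 0 as the recurrence lemma requires; the first equation survives since
   B^* y 0 = - B^* x = 0. *)
suff /(_ n.+1) : forall n, (if n is 0%N then 0 else y n) = 0 by [].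
pose K := \sum_(w <- s) \sum_i `|v w i 0|.
have K0 : 0 <= K by rewrite /K sumr_ge0// => w _; rewrite sumr_ge0.
apply: (decaying_recurrence_eq0 (K := K) pos _ _ r0 r1) => // {n} [n|n i].
  by case: n => [|n]; [rewrite mulmx0 -[X in _ + X]y0|]; exact: yrec.
case: n => [|n]; first by rewrite mxE normr0 mulr1.
rewrite /y summxE (le_trans (ler_norm_sum _ _ _))// /K mulr_suml big_seq.
rewrite [leRHS]big_seq ler_sum// => w ws.
rewrite mxE normrM normrX mulrC ler_pM ?exprn_ge0//.
  by rewrite (bigD1 i)//= lerDl sumr_ge0.
by rewrite lerXn2r ?nnegrE ?sr.
Qed.

End DecayingModes.

(** * Linear independence of indexed families *)

Lemma span_map_sum (K : fieldType) (vT : vectType K) (T : eqType) (s : seq T)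
    (u : T -> vT) (y : vT) :
  uniq s -> y \in <<[seq u w | w <- s]>>%VS ->
  exists c : T -> K, y = \sum_(w <- s) c w *: u w.
Proof.
elim: s y => [|a s IH] y /=.
  by rewrite span_nil memv0 => _ /eqP ->; exists (fun=> 0); rewrite big_nil.
case/andP=> nas us; rewrite span_cons => /memv_addP[_ /vlineP[k ->] [y' y's ->]].
have [c ->] := IH _ us y's; exists (fun w => if w == a then k else c w).
rewrite big_cons eqxx; congr (_ + _); apply: eq_big_seq => w ws.
by case: eqP ws nas => // -> ->.
Qed.

(** A relation on the tail extends by 0 at the head [a]; membership of [u a] in the span of the rest
    is a relation with coefficient -1 at [a]. *)
Lemma free_map_cat (K : fieldType) (vT : vectType K) (T : eqType) (s : seq T)
    (u : T -> vT) (U : seq vT) :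
  uniq s -> free U ->
  (forall (c : T -> K) x, x \in <<U>>%VS -> \sum_(w <- s) c w *: u w + x = 0 ->
    forall w, w \in s -> c w = 0) ->
  free ([seq u w | w <- s] ++ U).
Proof.
move=> + fU; elim: s => [//|a s IH] /= /andP[nas us] indep.
have ext (c : T -> K) k :
    \sum_(w <- a :: s) (if w == a then k else c w) *: u w =
    k *: u a + \sum_(w <- s) c w *: u w.
  rewrite big_cons eqxx; congr (_ + _); apply: eq_big_seq => w ws.
  by case: eqP ws nas => // -> ->.
rewrite free_cons; apply/andP; split; last first.
  apply: IH => // c x xU cx w ws.
  have := indep (fun w => if w == a then 0 else c w) x xU.
  rewrite ext scale0r add0r => /(_ cx w); rewrite inE ws orbT => /(_ isT).
  by case: eqP ws nas => // -> ->.
apply/negP; rewrite span_cat => /memv_addP[y ys [x xU uyx]].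
have [c yc] := span_map_sum us ys.
have := indep (fun w => if w == a then -1 else c w) x xU.
rewrite ext -yc scaleN1r uyx -addrA addNr => /(_ erefl a (mem_head _ _)).
by rewrite eqxx => /eqP; rewrite oppr_eq0 oner_eq0.
Qed.

(** * Adjugates and derivatives of matrix pencils *)

Lemma det0_col (F : fieldType) n (M : 'M[F]_n) :
  \det M = 0 -> exists2 x : 'cV_n, x != 0 & M *m x = 0.
Proof.
rewrite -det_tr => /eqP/det0P[v v0 vM]; exists v^T.
  by apply: contra_neq v0 => v0; rewrite -[v]trmxK v0 trmx0.
by rewrite -[M]trmxK -trmx_mul vM trmx0.
Qed.

Lemma adjZ (R : comNzRingType) n (a : R) (M : 'M[R]_n) :
  \adj (a *: M) = a ^+ n.-1 *: \adj M.
Proof.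
apply/matrixP => i j; rewrite !mxE /cofactor mulrCA; congr (_ * _).
rewrite -detZ; congr (\det _).
by apply/matrixP => k l; rewrite !mxE.
Qed.

Local Notation ev w M := (map_mx (horner_eval w) M).

(* Differentiate P *m \adj P = (\det P)%:M at w and multiply by v on the left,
   which kills the term involving the derivative of the adjugate. *)
Lemma adj_at_simple_root (F : fieldType) n (P : 'M[{poly F}]_n) (w : F)
    (u : 'cV[F]_n) (v : 'rV[F]_n) :
  root (\det P) w ->
  (forall x : 'cV_n, (ev w P) *m x = 0 -> exists c, x = c *: u) ->
  v *m (ev w P) = 0 ->
  (v *m (ev w (map_mx deriv P)) *m u) 0 0 *: (ev w (\adj P)) =
    (\det P)^`().[w] *: (u *m v).
Proof.
move=> rw ku vP.
(* P(w) adj P(w) = det P(w) = 0, so every column of the adjugate lies in the kernel and is a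
   multiple of [u]. *)
have [a adjE] : exists a : 'rV_n, (ev w (\adj P)) = u *m a.
  have kc j : exists c, col j (ev w (\adj P)) = c *: u.
    apply: ku; rewrite colE mulmxA -map_mxM mul_mx_adj.
    rewrite (_ : ev w _ = 0) ?mul0mx//.
    by apply/matrixP => i l; rewrite !mxE /horner_eval hornerMn (eqP rw) mul0rn.
  have [a ha] := fin_all_exists kc; exists (\row_j a j).
  apply/matrixP => i j; have /matrixP/(_ i 0) := ha j.
  by rewrite !mxE big_ord1 !mxE mulrC.
have deriv_mul : map_mx deriv (P *m \adj P)
    = map_mx deriv P *m \adj P + P *m map_mx deriv (\adj P).
  apply/matrixP => i j; rewrite !mxE raddf_sum -big_split /=; apply: eq_bigr => l _.
  by rewrite derivM !mxE.
have vq : v *m (ev w (map_mx deriv P)) *m u *m a = (\det P)^`().[w] *: v.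
  rewrite -mulmxA -adjE -mulmxA -map_mxM /=.
  have := congr1 (fun M => v *m (ev w M)) deriv_mul.
  rewrite map_mxD mulmxDr map_mxM [X in _ = _ + v *m X]map_mxM /= [X in _ = _ + X]mulmxA.
  rewrite vP mul0mx addr0 => <-.
  rewrite mul_mx_adj -mul_mx_scalar; congr (_ *m _).
  by apply/matrixP => i j; rewrite !mxE /horner_eval derivMn hornerMn.
by rewrite adjE [RHS]scalemxAr -vq [LHS]scalemxAr; congr (_ *m _);
  rewrite [X in _ = X *m _]mx11_scalar mul_scalar_mx.
Qed.

Lemma deriv_quadratic_pencil (F : fieldType) n (M2 M1 M0 : 'M[F]_n) (w : F) :
  ev w (map_mx deriv ('X^2 *: map_mx polyC M2 + 'X *: map_mx polyC M1
                      + map_mx polyC M0)) = (w *+ 2) *: M2 + M1.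
Proof.
apply/matrixP => i j; rewrite !mxE /horner_eval.
rewrite !(derivD, derivM, derivC, derivXn, derivX) !hornerE /=.
by rewrite addr0 mulr2n.
Qed.

(** With Phi(z) = M + z N + P / z, this is the product rule (z Phi)' = Phi + z Phi'. *)
Lemma laurent_euler (F : fieldType) (V : lmodType F) (M N P : V) (w : F) :
  w != 0 ->
  (w *+ 2) *: N + M = M + w *: N + w^-1 *: P + w *: (N - w ^- 2 *: P).
Proof.
move=> w0; rewrite scalerBr scalerA expr2 invfM mulVKf// mulr2n scalerDl.
by rewrite [RHS]addrACA subrr addr0 [LHS]addrC [LHS]addrA.
Qed.

Lemma size_adj_PsiX (R : realType) d (A : 'M[R[i]]_(d + d)) i j :
  (size (\adj (PsiX A) i j) <= (2 * d.-1).+1)%N.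
Proof.
rewrite mxE /cofactor -signr_odd.
by case: (odd _); rewrite ?expr0 ?expr1 ?mul1r ?mulN1r ?size_polyN;
  apply: size_det_le3 => a b; rewrite 2!mxE; exact: size_PsiX.
Qed.

(** * Symmetry and positivity of the Hermitian pencil *)

Section HermitianPencil.
Local Open Scope sesquilinear_scope.
Context (R : realType) (d : nat) (A : 'M[R[i]]_(d + d)).
Context (hA : hermitian_posdef A).
Local Notation C := R[i].

Lemma hermitian_trC : A ^t* = A.
Proof.
by case: hA => /is_hermitianmxP + _; rewrite expr0 scale1r => {2}->.
Qed.

Lemma blockLR_trC : (blockLR A) ^t* = blockRL A.
Proof. by rewrite /blockLR /blockRL trmx_ursub map_dlsubmx hermitian_trC. Qed.

Lemma blockRL_trC : (blockRL A) ^t* = blockLR A.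
Proof. by rewrite /blockLR /blockRL trmx_dlsub map_ursubmx hermitian_trC. Qed.

Lemma blockLL_trC : (blockLL A) ^t* = blockLL A.
Proof. by rewrite /blockLL trmx_ulsub map_ulsubmx hermitian_trC. Qed.

Lemma blockRR_trC : (blockRR A) ^t* = blockRR A.
Proof. by rewrite /blockRR trmx_drsub map_drsubmx hermitian_trC. Qed.

Lemma posdef_blocks (y z : 'cV[C]_d) : (y != 0) || (z != 0) ->
  0 < hdot y (blockLL A *m y) + hdot y (blockLR A *m z)
      + hdot z (blockRL A *m y) + hdot z (blockRR A *m z).
Proof.
move=> yz; have yz0 : col_mx y z != 0.
  by rewrite -col_mx0; apply: contraTneq yz => /eq_col_mx[-> ->]; rewrite eqxx.
have := hA.2 _ yz0; congr (0 < _); rewrite /hdot -{1}(submxK A) mul_block_col.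
have add11 (P Q : 'M[C]_1) : (P + Q) 0 0 = P 0 0 + Q 0 0 by rewrite mxE.
by rewrite tr_col_mx map_row_mx mul_row_col !mulmxDr !add11 addrA.
Qed.

Lemma posdef_LR (y z : 'cV[C]_d) : (y != 0) || (z != 0) ->
  0 < hdot y (blockLL A *m y) + hdot y (blockLR A *m z)
      + hdot z ((blockLR A) ^t* *m y) + hdot z (blockRR A *m z).
Proof. by rewrite blockLR_trC; exact: posdef_blocks. Qed.

(** For the modes outside the disk, where the roles of L and R are exchanged. *)
Lemma posdef_RL (y z : 'cV[C]_d) : (y != 0) || (z != 0) ->
  0 < hdot y (blockRR A *m y) + hdot y (blockRL A *m z)
      + hdot z ((blockRL A) ^t* *m y) + hdot z (blockLL A *m z).
Proof.
have sum4 (a b c e : C) : a + b + c + e = e + c + b + a by ring.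
by rewrite blockRL_trC orbC sum4; exact: posdef_blocks.
Qed.

Lemma Phi_trC (z : C) : (Phi A z) ^t* = Phi A (1 / z^* ).
Proof.
rewrite /Phi !linearD !linearZ /= !map_mxD !map_mxZ /=.
rewrite blockLL_trC blockRR_trC blockLR_trC blockRL_trC.
by rewrite div1r invrK fmorphV -addrA [_ *: blockRL A + _]addrC addrA.
Qed.

(** For |z| = 1 the energy of (x, z x) equals <x, Phi(z) x>, which vanishes on the kernel of
    Phi(z). *)
Lemma det_Phi_circle (z : C) : `|z| = 1 -> \det (Phi A z) != 0.
Proof.
move=> z1; apply/eqP => /det0_col[x x0 Px].
have zz : z^* * z = 1 by rewrite mulrC -normCK z1 expr1n.
have zV : z^* = z^-1.
  apply: (mulIf (_ : z != 0)); first by rewrite -normr_eq0 z1 oner_eq0.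
  by rewrite zz mulVf// -normr_eq0 z1 oner_eq0.
have := @posdef_blocks x (z *: x); rewrite x0 => /(_ isT).
have hdZr (a : C) (p q : 'cV[C]_d) : hdot p (a *: q) = a * hdot p q.
  by rewrite /hdot -scalemxAr mxE.
have hdZl (a : C) (p q : 'cV[C]_d) : hdot (a *: p) q = a^* * hdot p q.
  by rewrite /hdot linearZ map_mxZ /= -scalemxAl mxE.
rewrite -!scalemxAr !hdZl !hdZr mulrA zz mul1r zV.
have := congr1 (hdot x) Px; rewrite /Phi !mulmxDl !hdotDr -!scalemxAl !hdZr hdot0r.
have sum4 (p q r s : C) : p + q + r + s = 0 -> (0 < p + r + s + q) = false.
  by rewrite [p + r + s + q]addrAC (addrAC p r) => ->; rewrite ltxx.
by move/sum4 ->.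
Qed.

Lemma Psi_reversal (z : C) : z != 0 ->
  Psi A z = z ^+ 2 *: (Psi A (z^-1)^* ) ^t*.
Proof.
move=> z0; rewrite !PsiE ?conjC_eq0 ?invr_eq0// linearZ map_mxZ /= Phi_trC.
by rewrite !conjCK div1r invrK scalerA expr2 mulfK.
Qed.

Lemma detPsi_coef_conj l : (l <= 2 * d)%N ->
  (detPsi A)`_l = ((detPsi A)`_(2 * d - l))^*.
Proof.
have sz : (size (detPsi A) <= (2 * d).+1)%N.
  by apply: size_det_le3; exact: size_PsiX.
have ev z : (detPsi A).[z] = \det (Psi A z) by rewrite -map_PsiX det_map_mx.
apply: coef_conj_reversal => // z z0.
by rewrite !ev Psi_reversal// detZ -exprM det_map_mx det_tr.
Qed.

(** Entries of the adjugate are minors of size d - 1, so the reversal exponent is 2 (d - 1); the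
    conjugate transpose exchanges [i] and [j]. *)
Lemma adjPsi_coef_conj i j l : (l <= 2 * d.-1)%N ->
  (\adj (PsiX A) i j)`_l = ((\adj (PsiX A) j i)`_(2 * d.-1 - l))^*.
Proof.
have ev z a b : (\adj (PsiX A) a b).[z] = \adj (Psi A z) a b.
  by rewrite -map_PsiX -map_mx_adj [RHS]mxE.
move: l; apply: coef_conj_reversal => [||z z0]; try exact: size_adj_PsiX.
by rewrite !ev Psi_reversal// adjZ -exprM mxE -map_mx_adj -trmx_adj !mxE.
Qed.

End HermitianPencil.

(** * Roots and degree of det Psi *)

Section SingularSet.
Context (R : realType) (d k : nat) (A : 'M[R[i]]_(d + d)).
Context (hA : hermitian_posdef A) (hk : (1 <= k <= d)%N).
Context (hzero : mup 0 (detPsi A) = k).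
Context (hsimple : forall w : R[i], Sing A w -> mup w (detPsi A) = 1%N).
Local Notation C := R[i].
Local Notation q := (detPsi A).

Lemma hornerE_detPsi (z : C) : q.[z] = \det (Psi A z).
Proof. by rewrite -map_PsiX det_map_mx. Qed.

Lemma SingP (z : C) : z != 0 -> Sing A z <-> root q z.
Proof.
move=> z0; rewrite rootE hornerE_detPsi PsiE// detZ mulf_eq0 expf_eq0 (negPf z0) andbF.
by split=> [[_ /eqP]|/eqP].
Qed.

Lemma Sing_norm_neq1 (z : C) : Sing A z -> `|z| != 1.
Proof. by move=> [_ Pz]; apply: contra_eq_neq Pz; exact: det_Phi_circle. Qed.

Lemma Sing_conjV (z : C) : Sing A z -> Sing A (1 / z^*).
Proof.
move=> [z0 Pz]; split; first by rewrite div1r invr_eq0 conjC_eq0.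
by rewrite -(Phi_trC hA) det_map_mx det_tr Pz rmorph0.
Qed.

Lemma detPsi_neq0 : q != 0.
Proof.
apply: contraTneq (det_Phi_circle hA (normr1 C)) => q0.
by rewrite -[Phi A 1]scale1r -PsiE ?oner_eq0// -hornerE_detPsi q0 horner0 eqxx.
Qed.

Lemma detPsi_factor : exists2 q1 : {poly C}, q = q1 * 'X^k & q1`_0 != 0.
Proof.
have := mup_geq 0 k detPsi_neq0; rewrite hzero leqnn subr0 => /esym/dvdpP[q1 qE].
exists q1 => //; have := mup_leq 0 k detPsi_neq0; rewrite hzero leqnn subr0.
rewrite qE exprS dvdp_mul2r ?expf_neq0 ?polyX_eq0// => /esym; apply: contra => q10.
by rewrite -['X]subr0 dvdp_XsubCl rootE horner_coef0.
Qed.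

(** The root 0 of multiplicity k kills the k lowest coefficients; conjugate reversal moves these
    zeros to the top and carries the nonzero coefficient of index k to index 2 d - k. *)
Lemma size_detPsi : size q = (2 * d - k).+1.
Proof.
have [q1 qE q10] := detPsi_factor; case/andP: hk => k1 kd.
have qlow l : (l < k)%N -> q`_l = 0 by move=> lk; rewrite qE coefMXn lk.
apply/eqP; rewrite eqn_leq; apply/andP; split.
  apply/leq_sizeP => j jk; have [j2d|j2d] := leqP j (2 * d).
    by rewrite (detPsi_coef_conj hA)// qlow ?conjC0//; lia.
  by apply: nth_default; apply: leq_trans j2d; apply: size_det_le3; exact: size_PsiX.
rewrite ltnNge; apply/negP => /leq_sizeP/(_ _ (leqnn _))/eqP.
rewrite (detPsi_coef_conj hA) ?leq_subr// conjC_eq0 subKn; last by lia.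
by rewrite qE coefMXn ltnn subnn (negPf q10).
Qed.

(** Removing 'X^k leaves only nonzero roots, so they are the points of S, and the degree becomes (2
    d - k) - k. *)
Lemma detPsi_split : exists (s : seq C) (q1 : {poly C}),
  [/\ q = q1 * 'X^k, uniq s,
      size s = (2 * (d - k))%N /\ size q1 = (size s).+1,
      forall w, w \in s <-> Sing A w &
      forall w, w \in s -> root q1 w /\ q1^`().[w] != 0].
Proof.
have [q1 qE q10] := detPsi_factor; case/andP: (hk) => k1 kd.
have q1_neq0 : q1 != 0 by apply: contra_neq q10 => ->; rewrite coef0.
have [s sE] := closed_field_poly_normal q1.
have lq0 : lead_coef q1 != 0 by rewrite lead_coef_eq0.
have ms w : (w \in s) = root q1 w by rewrite sE rootZ// root_prod_XsubC.
have szs : size q1 = (size s).+1 by rewrite sE size_scale// size_prod_XsubC.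
have nz w : root q1 w -> w != 0.
  by apply: contraTneq => ->; rewrite rootE horner_coef0.
have rX w : w != 0 -> root ('X^k : {poly C}) w = false.
  by move=> w0; rewrite rootE hornerXn expf_eq0 (negPf w0) andbF.
have sSing w : w \in s <-> Sing A w.
  rewrite ms; split=> [rw|Sw].
    by apply/SingP; [exact: nz|rewrite qE rootM rw].
  have w0 := Sw.1; have /SingP-/(_ w0) := Sw.
  by rewrite qE rootM rX// orbF.
have mup1 w : w \in s -> mup w q1 = 1%N.
  move=> ws; rewrite -(hsimple ((sSing w).1 ws)) qE mupMl// rX//.
  by apply: nz; rewrite -ms.
exists s, q1; split=> //.
(* The count of [w] in [s] is its multiplicity as a root of [q1], which is 1. *)
- apply: count_mem_uniq => w; have [ws|/count_memPn//] := boolP (w \in s).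
  rewrite -mu_prod_XsubC -[RHS]/1%N -[RHS](mup1 w ws) [in RHS]sE -mul_polyC mupMr//.
  by rewrite rootC.
- split=> //; have := size_detPsi; rewrite qE size_mulXn// szs => /eqP.
  rewrite addnS eqSS => /eqP szE.
  by apply: (@addnI k); rewrite [LHS]szE; lia.
- by move=> w /mup1 m1; exact: deriv_simple_root.
Qed.

Lemma PsiX_pencil : PsiX A = map_mx polyC (blockRL A)
  + 'X *: ('X *: map_mx polyC (blockLR A) + map_mx polyC (blockLL A + blockRR A)).
Proof. by rewrite scalerDr scalerA -expr2 addrC. Qed.

(** * Residues and the resolvent formula *)

Section Eigenvectors.
Local Open Scope sesquilinear_scope.
Context (u : C -> 'cV[C]_d).
Context (hu0 : forall w : C, Sing A w -> u w != 0).
Context (hu : forall w : C, Sing A w -> <[u w]>%VS = kerv (Phi A w)).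

Lemma Phi_u w : Sing A w -> Phi A w *m u w = 0.
Proof. by move=> Sw; apply/eqP; rewrite -mem_kerv -hu// memv_line. Qed.

(** Instance of [adj_at_simple_root] whose left null vector comes from Phi(w)^* = Phi(1/conj w). The
    factor w on the pairing is due to Psi'(w) u_w = w Phi'(w) u_w. *)
Lemma adjPsi_Sing w : Sing A w ->
  (w * pairing A u w) *: \adj (Psi A w) = q^`().[w] *: Pw u w.
Proof.
move=> Sw; have w0 := Sw.1.
have rw : root (\det (PsiX A)) w by exact: (SingP w0).1.
have ku x : map_mx (horner_eval w) (PsiX A) *m x = 0 -> exists c, x = c *: u w.
  rewrite map_PsiX PsiE// -scalemxAl => /eqP; rewrite scaler_eq0 (negPf w0) /=.
  by rewrite -mem_kerv -hu// => /vlineP.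
have vP : (u (1 / w^* )) ^t* *m map_mx (horner_eval w) (PsiX A) = 0.
  rewrite map_PsiX PsiE// -scalemxAr; have := Phi_u (Sing_conjV Sw).
  rewrite -(Phi_trC hA) => /(congr1 (fun M => M ^t*)).
  rewrite trmx_mul map_mxM /= trmx0 map_mx0 trmxCK => ->.
  by rewrite scaler0.
have := adj_at_simple_root rw ku vP.
rewrite -map_PsiX map_mx_adj => <-; congr (_ *: _).
rewrite /pairing /hdot dPhiE// -[in RHS]mulmxA.
have -> : map_mx (horner_eval w) (map_mx deriv (PsiX A)) =
    Phi A w + w *: (blockLR A - w ^- 2 *: blockRL A).
  by rewrite deriv_quadratic_pencil; exact: laurent_euler.
by rewrite [in RHS]mulmxDl Phi_u// add0r -scalemxAl -scalemxAr [RHS]mxE.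
Qed.

(** A zero pairing would make q'(w) P_w vanish, but w is a simple root and [Pw] is a column times a
    row, both nonzero. *)
Lemma pairing_neq0 w : Sing A w -> pairing A u w != 0.
Proof.
move=> Sw; apply/eqP => p0; have := adjPsi_Sing Sw; rewrite p0 mulr0 scale0r.
have [_ q'0] := deriv_simple_root (hsimple Sw) detPsi_neq0.
move/esym/eqP; rewrite scaler_eq0 (negPf q'0) /=; apply/negP.
have /matrix0Pn[i [j]] := hu0 Sw; rewrite (ord1 j) => ui.
have /matrix0Pn[l [m]] := hu0 (Sing_conjV Sw); rewrite (ord1 m) => ul.
apply/matrix0Pn; exists i, l; rewrite mxE big_ord1 !mxE mulf_neq0//.
by rewrite conjC_eq0.
Qed.

(** Reversal reflects the k - 1 vanishing low coefficients to the top, so the adjugate has degree at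
    most 2 (d - 1) - (k - 1); dividing by 'X^(k-1) leaves 2 (d - k). *)
Lemma adj_PsiX_factor : \rank (blockLR A) = (d - k)%N ->
  exists2 Q : 'M[{poly C}]_d, \adj (PsiX A) = 'X^(k.-1) *: Q &
    forall i j, (size (Q i j) <= (2 * (d - k)).+1)%N.
Proof.
move=> rk; case/andP: (hk) => k1 kd.
have rRL : \rank (blockRL A) = (d - k)%N.
  by rewrite -(blockLR_trC hA) mxrank_map mxrank_tr.
have [Q adjE] : exists Q : 'M[{poly C}]_d, \adj (PsiX A) = 'X^(k.-1) *: Q.
  have := detPsi_neq0; rewrite /detPsi PsiX_pencil; exact: adj_linear_pencil.
exists Q => // i j.
have adjQ i' j' l : (\adj (PsiX A) i' j')`_l = if (l < k.-1)%N then 0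
                                              else (Q i' j')`_(l - k.-1).
  by rewrite adjE mxE coefXnM.
apply/leq_sizeP => l lk.
have := adjQ i j (l + k.-1)%N; rewrite ltnNge leq_addl /= addnK => <-.
have [l2d|l2d] := leqP (l + k.-1) (2 * d.-1).
  rewrite (adjPsi_coef_conj hA)// adjQ ifT ?conjC0//; lia.
by rewrite nth_default//; apply: leq_trans l2d; exact: size_adj_PsiX.
Qed.

Lemma invmx_Phi_poles z : \rank (blockLR A) = (d - k)%N ->
  z != 0 -> ~ Sing A z ->
  invmx (Phi A z) =
    \sum_(w \in Sing A) ((alpha A u w / (z - w)) *: Pw u w)
    + (1 / p_coef A (2 * d - k)) *: Psi_coef A (2 * d - k - 1).
Proof.
move=> rk z0 Sz; case/andP: (hk) => k1 kd.
have [s [q1 [qE us [szs szq1] sS q1']]] := detPsi_split.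
have [Q adjE szQ] := adj_PsiX_factor rk.
have qz0 : q.[z] != 0 by apply/negP => qz; apply/Sz/SingP.
have q1z0 : q1.[z] != 0.
  by apply: contraNneq qz0 => q1z; rewrite qE hornerM q1z mul0r.
have adj_ev y i j : \adj (Psi A y) i j = y ^+ k.-1 * (Q i j).[y].
  rewrite -map_PsiX -map_mx_adj [LHS]mxE.
  by rewrite -[LHS]/((\adj (PsiX A) i j).[y]) adjE mxE hornerM hornerXn.
have invE : invmx (Phi A z) = (z / q.[z]) *: \adj (Psi A z).
  have PhiV : Phi A z *m ((z / q.[z]) *: \adj (Psi A z)) = 1%:M.
    rewrite -scalemxAr mulrC -scalerA scalemxAl -PsiE// mul_mx_adj.
    by rewrite -hornerE_detPsi scale_scalar_mx mulVf.
  have [PhiU _] := mulmx1_unit PhiV.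
  by rewrite -[RHS](mulKmx PhiU) PhiV mulmx1.
have -> : \sum_(w \in Sing A) ((alpha A u w / (z - w)) *: Pw u w) =
    \sum_(w <- s) ((alpha A u w / (z - w)) *: Pw u w).
  have -> : Sing A = [set` s] by apply/seteqP; split=> w /sS.
  by rewrite -fsbig_seq.
apply/matrixP => i j; rewrite invE [in RHS]mxE summxE mxE adj_ev.
(* In Phi^-1 = z adj Psi / det Psi, the factor z and the z^(k-1) of the adjugate cancel the z^k of
   the determinant. *)
have -> : z / q.[z] * (z ^+ k.-1 * (Q i j).[z]) = (Q i j).[z] / q1.[z].
  have -> : q.[z] = z * z ^+ k.-1 * q1.[z].
    by rewrite qE hornerM hornerXn -exprS prednK// mulrC.
  by field; rewrite q1z0 expf_eq0 (negPf z0) andbF.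
rewrite (partial_fractions us) ?szq1//.
(* Since 2 d - k - 1 - (k - 1) = 2 (d - k), the constant matrix holds the coefficients of [Q] of
   index 2 (d - k), and p_(2d-k) is the leading coefficient of [q1]. *)
- congr (_ + _); last first.
    rewrite mxE /p_coef /Psi_coef mxE adjE mxE coefXnM lead_coefE szq1 /= szs.
    rewrite qE coefMXn div1r [LHS]mulrC !ifF; [|lia|lia].
    have -> : (2 * d - k - k = 2 * (d - k))%N by lia.
    by have -> : (2 * d - k - 1 - k.-1 = 2 * (d - k))%N by lia.
  apply: eq_big_seq => w ws; have Sw := (sS w).1 ws; have w0 := Sw.1.
  have [/eqP q1w q1'w] := q1' w ws.
  have /matrixP/(_ i j) := adjPsi_Sing Sw.
  rewrite [LHS]mxE [RHS]mxE adj_ev.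
  (* As q1(w) = 0, only w^k q1'(w) remains; its w^k cancels the w of the pairing term and the
     w^(k-1) of the adjugate. *)
  have -> : q^`().[w] = w * w ^+ k.-1 * q1^`().[w].
    rewrite qE derivM hornerD !hornerM q1w mul0r addr0 hornerXn mulrC.
    by rewrite -exprS prednK.
  have ww0 : w * w ^+ k.-1 != 0 by rewrite mulf_neq0// expf_neq0.
  have p0 := pairing_neq0 Sw; set p := pairing _ _ _ in p0 *.
  move=> E; have {}E : p * (Q i j).[w] = q1^`().[w] * Pw u w i j.
    by apply: (mulfI ww0); rewrite [RHS]mulrA -E; ring.
  have -> : (Q i j).[w] = q1^`().[w] * Pw u w i j / p by rewrite -E mulrAC mulfV// mul1r.
  by rewrite [RHS]mxE /alpha -/p; move: (Pw u w i j) (z - w)^-1 => a b; field;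
    rewrite p0 q1'w.
- by apply/allP => w /q1'[].
- by rewrite szs.
- by move=> w /q1'[].
Qed.

(** * Counting the singularities and the two bases *)

Lemma finite_SingI (P : set C) : finite_set (Sing A `&` P).
Proof.
apply: sub_finite_set (@subIsetl _ _ _) _; apply: finite_Sing.
by rewrite hzero; case/andP: hk.
Qed.

Lemma Sing_lt1P w : w \in fset_set (Sing_lt1 A) <-> Sing_lt1 A w.
Proof. by rewrite in_fset_set ?inE//; exact: finite_SingI. Qed.

Lemma Sing_gt1P w : w \in fset_set (Sing_gt1 A) <-> Sing_gt1 A w.
Proof. by rewrite in_fset_set ?inE//; exact: finite_SingI. Qed.

Lemma normr_conjV (w : C) : `|1 / w^*| = `|w|^-1.
Proof. by rewrite div1r normfV norm_conjC. Qed.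

Lemma conjVK (w : C) : 1 / (1 / w^*)^* = w.
Proof. by rewrite !div1r -fmorphV invrK /= conjCK. Qed.

(** The map w -> 1/conj w is a bijection between the two sets, which together exhaust the 2 (d - k)
    roots, none being on the circle. *)
Lemma size_Sing_lt1_gt1 : size (fset_set (Sing_lt1 A)) = (d - k)%N /\
  size (fset_set (Sing_gt1 A)) = (d - k)%N.
Proof.
have [s [q1 [_ us [szs _] sS _]]] := detPsi_split.
set S1 := fset_set _; set S2 := fset_set _.
have w0 w : Sing A w -> 0 < `|w| by case; rewrite normr_gt0.
have S12 : size S1 = size S2.
  rewrite -(size_map (fun w => 1 / w^*) S1); apply/perm_size/uniq_perm.
  - by rewrite map_inj_uniq ?fset_uniq//; exact: (can_inj (g := fun w : C => 1 / w^* ) conjVK).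
  - exact: fset_uniq.
  move=> w; apply/mapP/idP => [[v /Sing_lt1P[Sv v1] ->]|/Sing_gt1P[Sw w1]].
    apply/Sing_gt1P; split; first exact: Sing_conjV.
    by rewrite normr_conjV invf_gt1// w0.
  exists (1 / w^*); last by rewrite conjVK.
  apply/Sing_lt1P; split; first exact: Sing_conjV.
  by rewrite normr_conjV invf_lt1// w0.
have : perm_eq s (S1 ++ S2).
  apply: uniq_perm => //.
    rewrite cat_uniq !fset_uniq /= andbT; apply/hasPn => w /Sing_gt1P[_ w1].
    by apply/negP => /Sing_lt1P[_ /lt_trans/(_ w1)]; rewrite ltxx.
  move=> w; rewrite mem_cat; apply/idP/orP => [/sS Sw|[/Sing_lt1P[]|/Sing_gt1P[]]].
  - have := Sing_norm_neq1 Sw.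
    have [w1 _|w1 _|//] := real_ltgtP (normr_real w) (@real1 C).
    + by left; apply/Sing_lt1P.
    + by right; apply/Sing_gt1P.
  - by move=> /sS.
  - by move=> /sS.
have half n : (2 * (d - k) = n + n)%N -> n = (d - k)%N by lia.
by move=> /perm_size; rewrite [size s]szs size_cat -S12 => /half ->.
Qed.

(** Serves both bases: [e] is the identity inside the disk and the inverse outside, with the blocks
    exchanged. There are (d - k) + k vectors, so freeness is enough. *)
Lemma basis_modes (S : seq C) (U : k.-tuple 'cV[C]_d) (M1 M2 B : 'M[C]_d)
    (e : C -> C) :
  (forall y z, (y != 0) || (z != 0) ->
    0 < hdot y (M1 *m y) + hdot y (B *m z) + hdot z (B ^t* *m y)
        + hdot z (M2 *m z)) ->
  uniq S -> size S = (d - k)%N -> injective e ->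
  (forall w, w \in S -> [/\ Sing A w, e w != 0, `|e w| < 1 &
    M1 + M2 + e w *: B + (e w)^-1 *: B ^t* = Phi A w]) ->
  basis_of (kerv (B ^t* )) U -> basis_of fullv ([seq u w | w <- S] ++ U).
Proof.
move=> pos uS szS inj_e hS /andP[/eqP spanU freeU].
rewrite basisEfree subvf dimvf dim_matrix size_cat size_map size_tuple szS.
(* The dimension of 'cV_d computes to d * 1. *)
rewrite [X in (X <= _)%N](muln1 d : _ = d) subnK ?leqnn ?andbT; last by case/andP: hk.
apply: free_map_cat => // c x; rewrite spanU mem_kerv => /eqP Bx cx w wS.
(* The modes are indexed by [e w] but the eigenvectors by [w], whence a left inverse of [e] on
   [S]. *)
have [e' eK] : exists e' : C -> C, {in S, cancel e e'}.
  exists (fun z => nth 0 S (index z (map e S))) => v vS.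
  by rewrite index_map// nth_index.
have := @decaying_modes_eq0 _ _ M1 M2 B (map e S) (fun z => c (e' z) *: u (e' z)) x pos.
rewrite map_inj_uniq// => /(_ uS _ _ Bx _ (e w)) H.
suff : c w *: u w = 0.
  by move/eqP; rewrite scaler_eq0 (negPf (hu0 _)) ?orbF => [/eqP//|]; case: (hS w wS).
have := H; rewrite eK//; apply.
- by move=> _ /mapP[v vS ->]; case: (hS v vS).
- move=> _ /mapP[v vS ->]; have [Sv _ _ ->] := hS v vS.
  by rewrite eK// -scalemxAr Phi_u// scaler0.
- rewrite big_map -[RHS]cx; congr (_ + _); apply: eq_big_seq => v vS.
  by rewrite eK.
- exact: map_f.
Qed.

End Eigenvectors.

End SingularSet.

Theorem theorem7p1 (R : realType) (d k : nat) (A : 'M[R[i]]_(d + d))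
    (uLR uRL : k.-tuple 'cV[R[i]]_d) (u : R[i] -> 'cV[R[i]]_d)
    (hd : (1 <= d)%N) (hk : (1 <= k <= d)%N) (hA : hermitian_posdef A)
    (hrank : \rank (blockLR A) = (d - k)%N)
    (huLR : basis_of (kerv (blockLR A)) uLR)
    (huRL : basis_of (kerv (blockRL A)) uRL)
    (hsimple : forall w : R[i], Sing A w -> mup w (detPsi A) = 1%N)
    (hdim : forall w : R[i], Sing A w -> \dim (kerv (Phi A w)) = 1%N)
    (hzero : mup 0 (detPsi A) = k)
    (hu0 : forall w : R[i], Sing A w -> u w != 0)
    (hu : forall w : R[i], Sing A w -> <[u w]>%VS = kerv (Phi A w)) :
  [/\ forall w : R[i], Sing A w -> pairing A u w != 0,
      forall z : R[i], z != 0 -> ~ Sing A z ->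
        invmx (Phi A z) =
          \sum_(w \in Sing A) ((alpha A u w / (z - w)) *: Pw u w)
          + (1 / p_coef A (2 * d - k)) *: Psi_coef A (2 * d - k - 1),
      basis_of fullv ([seq u w | w <- fset_set (Sing_lt1 A)] ++ uRL)
    & basis_of fullv ([seq u w | w <- fset_set (Sing_gt1 A)] ++ uLR)].
Proof.
have inj_id : injective (@id R[i]) by [].
have inj_inv : injective (fun w : R[i] => w^-1) := can_inj (@invrK _).
have [sz1 sz2] := size_Sing_lt1_gt1 hA hk hzero hsimple.
split.
- by move=> w Sw; exact: (pairing_neq0 hA hsimple hu0 hu).
- by move=> z z0 Sz; exact: (invmx_Phi_poles hA hk hzero hsimple hu0 hu).
- apply: (@basis_modes _ _ _ _ hk _ hu0 hu _ uRL _ _ _ id (posdef_LR hA)).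
  + exact: fset_uniq.
  + exact: sz1.
  + exact: inj_id.
  + move=> w /(Sing_lt1P hk hzero)[Sw w1].
    by split; [exact: Sw|exact: Sw.1|exact: w1|rewrite blockLR_trC].
  + by rewrite blockLR_trC.
(* Here M1 = A_RR, M2 = A_LL and B = A_RL, so that B^* = A_LR and 1/w is the decaying rate. *)
- apply: (@basis_modes _ _ _ _ hk _ hu0 hu _ uLR _ _ _ (fun w => w^-1) (posdef_RL hA)).
  + exact: fset_uniq.
  + exact: sz2.
  + exact: inj_inv.
  + move=> w /(Sing_gt1P hk hzero)[Sw w1].
    have w0 : 0 < `|w| by rewrite normr_gt0 Sw.1.
    split; [exact: Sw| | |].
    * by rewrite invr_eq0 Sw.1.
    * by rewrite normfV invf_lt1.
    * rewrite blockRL_trC// invrK [blockRR A + _]addrC.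
      by rewrite /Phi addrAC.
  + by rewrite blockRL_trC.
Qed.
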